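(* Let $A=(a_{nk})$ be an infinite real matrix and let $\bar{A}=(\bar a_{nk})$ be the associated matrix, $\bar a_{nk}=\sum_{j=k}^{\infty}\frac{f_{j+1}^{2}}{f_kf_{k+1}}a_{nj}$. Then: (a) If $A\in(\ell_\infty(\widehat F),\ell_\infty)$, then $$0\le \|L_A\|_\chi\le \limsup_{n\to\infty}\sum_{k}|\bar a_{nk}|,$$ and $L_A$ is compact if $\lim_{n\to\infty}\sum_k|\bar a_{nk}|=0$. (b) If $A\in(\ell_\infty(\widehat F),c_0)$, then $$\|L_A\|_\chi= \limsup_{n\to\infty}\sum_{k}|\bar a_{nk}|,$$ and $L_A$ is compact if and only if $\lim_{n\to\infty}\sum_k|\bar a_{nk}|=0$. (c) If $A\in(\ell_\infty(\widehat F),c)$, then $$\tfrac12\limsup_{n\to\infty}\sum_{k}|\bar a_{nk}-\bar\alpha_k|\le\|L_A\|_\chi\le \limsup_{n\to\infty}\sum_{k}|\bar a_{nk}-\bar\alpha_k|,$$ and $L_A$ is compact if and only if $\lim_{n\to\infty}\sum_k|\bar a_{nk}-\bar\alpha_k|=0$, where $\bar\alpha_k=\lim_{n\to\infty}\bar a_{nk}$ for all $k\in\mathbb N$.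
   Context: $\mathbb N=\{0,1,2,\dots\}$; sums $\sum_k$ run over $k\in\mathbb N$. $\omega$ is the space of all real sequences $x=(x_k)_{k\in\mathbb N}$; $\ell_\infty$, $c$, $c_0$ are the spaces of bounded, convergent, null real sequences with the sup norm. Fibonacci numbers: $f_0=f_1=1$, $f_n=f_{n-1}+f_{n-2}$ for $n\ge2$. For $x\in\omega$ the sequence $y=\widehat F x$ is given by $y_0=\frac{f_0}{f_1}x_0=x_0$ and $y_n=\frac{f_n}{f_{n+1}}x_n-\frac{f_{n+1}}{f_n}x_{n-1}$ for $n\ge1$. $\ell_\infty(\widehat F)=\{x\in\omega:\widehat F x\in\ell_\infty\}$, a Banach space with norm $\|x\|_{\ell_\infty(\widehat F)}=\|\widehat Fx\|_{\ell_\infty}$. For sequence spaces $X,Y$, $(X,Y)$ is the set of infinite real matrices $A=(a_{nk})_{n,k\in\mathbb N}$ such that for every $x\in X$ the series $A_n(x)=\sum_k a_{nk}x_k$ converges for every $n$ and $Ax=(A_n(x))_n\in Y$. For $A\in(X,Y)$, $L_A:X\to Y$ is the linear operator $L_A(x)=Ax$ (bounded for the spaces considered here). For $A\in(\ell_\infty(\widehat F),Y)$ the series defining $\bar a_{nk}$ converge for all $n,k$. Hausdorff measure of noncompactness: for a bounded subset $Q$ of a metric space $Y$, $\chi(Q)$ is the infimum of all $\varepsilon>0$ such that $Q$ is covered by finitely many balls $B(x_i,r_i)$ with centres $x_i\in Y$ and radii $r_i<\varepsilon$. For a bounded linear operator $L:X\to Y$ between Banach spaces, $\|L\|_\chi=\chi(L(S_X))$,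 where $S_X$ is the unit sphere of $X$ and $\chi$ is taken in $Y$. A linear operator $L:X\to Y$ defined on all of $X$ is compact if $L(Q)$ is totally bounded for every bounded $Q\subset X$. *)

(* Defs.v *)
From mathcomp Require Import all_boot all_order all_algebra.
From mathcomp Require Import all_classical all_reals all_analysis.
Set Implicit Arguments.
Unset Strict Implicit.
Unset Printing Implicit Defensive.
Import Order.TTheory GRing.Theory Num.Theory.
Import numFieldNormedType.Exports.
Local Open Scope classical_set_scope.
Local Open Scope ring_scope.

Fixpoint fib (n : nat) : nat :=
  match n with
  | 0 => 1
  | m.+1 => match m with 0 => 1 | l.+1 => fib m + fib l end
  end.

(* Radii of covering balls may vary; centres must lie in the space [Y], which
   is the subset [Y] of [T] with the metric [d]. *)
Definition metric_ball (R : realType) (T : Type) (Y : set T) (d : T -> T -> R)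
    (x : T) (r : R) : set T :=
  [set y | Y y /\ d x y < r].

Definition hausdorff_mnc (R : realType) (T : Type) (Y : set T)
    (d : T -> T -> R) (Q : set T) : \bar R :=
  ereal_inf [set eps%:E | eps in [set eps : R | 0 < eps /\
    exists (m : nat) (x : 'I_m -> T) (r : 'I_m -> R),
      [/\ forall i, Y (x i),
          forall i, 0 < r i < eps &
          Q `<=` \bigcup_(i in setT) metric_ball Y d (x i) (r i)]]].

Definition totally_bounded (R : realType) (T : Type) (Y : set T)
    (d : T -> T -> R) (Q : set T) : Prop :=
  forall eps : R, 0 < eps ->
    exists (m : nat) (x : 'I_m -> T),
      (forall i, Y (x i)) /\
      Q `<=` \bigcup_(i in setT) metric_ball Y d (x i) eps.

(* A set of real sequences with a norm; the norm is only meaningful on the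
   set, and is a junk value elsewhere. *)
Record seq_space (R : realType) := SeqSpace {
  carrier : set (nat -> R);
  seq_norm : (nat -> R) -> R }.

Definition seq_dist (R : realType) (X : seq_space R) (x y : nat -> R) : R :=
  seq_norm X (fun k => x k - y k).

Definition unit_sphere (R : realType) (X : seq_space R) : set (nat -> R) :=
  [set x | carrier X x /\ seq_norm X x = 1].

Definition bounded_in (R : realType) (X : seq_space R) (Q : set (nat -> R)) :
    Prop :=
  Q `<=` carrier X /\ exists M : R, forall x, Q x -> seq_norm X x <= M.

Definition sup_norm (R : realType) (x : nat -> R) : R :=
  sup (range (fun k => `|x k|)).

Definition ell_infty (R : realType) : seq_space R :=
  SeqSpace [set x : nat -> R | bounded_fun x] (@sup_norm R).

Definition c_conv (R : realType) : seq_space R :=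
  SeqSpace [set x : nat -> R | cvgn x] (@sup_norm R).

Definition c_null (R : realType) : seq_space R :=
  SeqSpace [set x : nat -> R | x @ \oo --> (0 : R)] (@sup_norm R).

Definition Fhat (R : realType) (x : nat -> R) (n : nat) : R :=
  match n with
  | 0 => (fib 0)%:R / (fib 1)%:R * x 0%N
  | m.+1 => (fib n)%:R / (fib n.+1)%:R * x n - (fib n.+1)%:R / (fib n)%:R * x m
  end.

Definition ell_infty_Fhat (R : realType) : seq_space R :=
  SeqSpace [set x | carrier (ell_infty R) (Fhat x)]
           (fun x => seq_norm (ell_infty R) (Fhat x)).

(* [limn] is total, with a junk value when the series diverges;
   [matrix_class] requires convergence explicitly. *)
Definition matrix_op (R : realType) (a : nat -> nat -> R) (x : nat -> R) :
    nat -> R :=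
  fun n => limn (series (fun k => a n k * x k)).

Definition matrix_class (R : realType) (X Y : seq_space R) :
    set (nat -> nat -> R) :=
  [set a | forall x, carrier X x ->
    (forall n, cvgn (series (fun k => a n k * x k))) /\ carrier Y (matrix_op a x)].

Definition mnc_norm (R : realType) (X Y : seq_space R)
    (L : (nat -> R) -> nat -> R) : \bar R :=
  hausdorff_mnc (carrier Y) (seq_dist Y) (L @` unit_sphere X).

Definition compact_op (R : realType) (X Y : seq_space R)
    (L : (nat -> R) -> nat -> R) : Prop :=
  forall Q, bounded_in X Q -> totally_bounded (carrier Y) (seq_dist Y) (L @` Q).

(* For [a] in [matrix_class (ell_infty_Fhat R) Y], the limits defining [abar]
   exist when [Y] is [ell_infty R], [c_conv R] or [c_null R], and those defining
   [alphabar] exist when [Y] is [c_conv R] or [c_null R]. *)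
Definition abar (R : realType) (a : nat -> nat -> R) (n k : nat) : R :=
  limn (fun N => \sum_(k <= j < N)
    (fib j.+1)%:R ^+ 2 / ((fib k)%:R * (fib k.+1)%:R) * a n j).

Definition alphabar (R : realType) (a : nat -> nat -> R) (k : nat) : R :=
  limn (fun n => abar a n k).

Definition abs_sum (R : realType) (u : nat -> R) : \bar R :=
  (\sum_(0 <= k <oo) (`|u k|%R)%:E)%E.

(* Main.v *)
Require Import Defs.
From mathcomp Require Import all_boot all_order all_algebra.
From mathcomp Require Import all_classical all_reals all_analysis.
From mathcomp Require Import ring lra zify.
Import Order.TTheory GRing.Theory Num.Theory.
Import numFieldNormedType.Exports.
Local Open Scope classical_set_scope.
Local Open Scope ring_scope.

(* The inverse of [Fhat] maps [y] to
   [x_j = f_(j+1)^2 * \sum_(k <= j) y_k / (f_k f_(k+1))], and summation by parts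
   turns [A x] into [abar y], where the rows of [abar] lie in l1 because
   [f_k f_(k+1) >= 2^k]. The image of the unit sphere is then covered by a finite
   net in the first [N] coordinates together with a bound on the tails of the
   rows, which gives the upper estimate of (a) and the compactness criteria.
   For (b) and (c), Schur's theorem shows that the row differences
   [abar n - alphabar] (with [alphabar = 0] in (b)) always tend to 0 in l1, so
   that all the quantities involved vanish and the operators are compact. *)

(** * The pairing of l1 sequences with bounded sequences *)

Definition dot {R : realType} (b y : nat -> R) : R :=
  limn (series (fun k => b k * y k)).

(** Bounding partial sums stays within the reals and presupposes no convergence; [abs_sum_leP] ties
    this to [abs_sum]. *)
Definition l1_bound {R : realType} (b : nat -> R) (r : R) : Prop :=
  forall K, \sum_(0 <= k < K) `|b k| <= r.

Lemma bounded_funE {R : realType} (y : nat -> R) :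
  bounded_fun (y : nat -> R^o) <-> exists M, forall k, `|y k| <= M.
Proof.
split=> [[M [_ yM]]|[M yM]].
  by exists (M + 1) => k; apply: yM; rewrite ?ltrDl.
by exists M; split; [exact: num_real|move=> x Mx k _; exact/(le_trans (yM k))/ltW].
Qed.

Lemma l1_bound_ge0 {R : realType} {b : nat -> R} {r} : l1_bound b r -> 0 <= r.
Proof. by move=> /(_ 0%N); rewrite big_geq. Qed.

Lemma l1_boundD {R : realType} {b c : nat -> R} {r s} :
  l1_bound b r -> l1_bound c s -> l1_bound (fun k => b k + c k) (r + s).
Proof.
move=> br cs K; apply: le_trans (lerD (br K) (cs K)).
by rewrite -big_split; apply: ler_sum => k _; exact: ler_normD.
Qed.

Lemma l1_boundN {R : realType} {b : nat -> R} {r} :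
  l1_bound b r -> l1_bound (fun k => - b k) r.
Proof. by move=> br K; under eq_bigr do rewrite normrN. Qed.

Lemma l1_dot_cvg {R : realType} {b y : nat -> R} {r M : R} :
  l1_bound b r -> (forall k, `|y k| <= M) ->
  cvgn (series (fun k => b k * y k)).
Proof.
move=> br yM; apply: normed_cvg; apply: nondecreasing_is_cvgn.
  by apply: nondecreasing_series => *; exact: normr_ge0.
exists (r * M) => _ [n _ <-]; rewrite /series /=.
have M0 : 0 <= M by exact: le_trans (yM 0%N).
apply: (@le_trans _ _ ((\sum_(0 <= k < n) `|b k|) * M)); last first.
  by rewrite ler_wpM2r.
by rewrite mulr_suml; apply: ler_sum => k _; rewrite normrM ler_wpM2l.
Qed.

Lemma l1_dot_le {R : realType} {b y : nat -> R} {r M : R} :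
  l1_bound b r -> (forall k, `|y k| <= M) -> `|dot b y| <= r * M.
Proof.
move=> br yM; have cv := l1_dot_cvg br yM.
have M0 : 0 <= M by exact: le_trans (yM 0%N).
have psum n : `|series (fun k => b k * y k) n| <= r * M.
  apply: (le_trans (ler_norm_sum _ _ _)).
  apply: (@le_trans _ _ ((\sum_(0 <= k < n) `|b k|) * M)); last first.
    by rewrite ler_wpM2r.
  by rewrite mulr_suml; apply: ler_sum => k _; rewrite normrM ler_wpM2l.
rewrite ler_norml; apply/andP; split.
  by apply: limr_ge => //; apply: nearW => n; have /ler_normlP [] := psum n; lra.
by apply: limr_le => //; apply: nearW => n; have /ler_normlP [] := psum n; lra.
Qed.

Lemma dotB {R : realType} {b c y : nat -> R} {r s M : R} :
  l1_bound b r -> l1_bound c s -> (forall k, `|y k| <= M) ->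
  dot (fun k => b k - c k) y = dot b y - dot c y.
Proof.
move=> br cs yM; apply: cvg_lim => //.
rewrite (_ : series _ = series (fun k => b k * y k) \- series (fun k => c k * y k)).
  by apply: cvgB; [exact: l1_dot_cvg br yM|exact: l1_dot_cvg cs yM].
apply/funext => n; rewrite /series /= -sumrB.
by apply: eq_bigr => k _; rewrite mulrBl.
Qed.

Lemma dot_delta {R : realType} (b : nat -> R) k :
  dot b (fun j => (j == k)%:R) = b k.
Proof.
apply: cvg_lim => //; apply: cvg_near_cst; near=> n.
rewrite /series /= (bigD1_seq k) ?iota_uniq //=; last first.
  by rewrite mem_index_iota; near: n; exact: nbhs_infty_gt.
by rewrite eqxx mulr1 big1 ?addr0 // => i /negPf ->; rewrite mulr0.
Unshelve. all: by end_near. Qed.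

(** * Schur's theorem: weakly convergent sequences in l1 converge in norm *)

Lemma l1_tail {R : realType} {b : nat -> R} {r e : R} : l1_bound b r -> 0 < e ->
  exists m, forall n p, (m <= n)%N -> \sum_(n <= k < p) `|b k| <= e.
Proof.
move=> br e0; set u := fun n => \sum_(0 <= k < n) `|b k|.
have und : nondecreasing_seq u.
  by apply/nondecreasing_seqP => n; rewrite /u big_nat_recr //= lerDl.
have cu : cvgn u.
  by apply: nondecreasing_is_cvgn => //; exists r => _ [n _ <-]; exact: br.
have /cvgrPdist_le /(_ e e0) [m _ mP] := cu.
exists m => n p mn.
case: (leqP n p) => [np|/ltnW pn]; last by rewrite big_geq //; exact: ltW.
have := mP n mn; have := nondecreasing_cvgn_le und cu p.
rewrite /u (big_cat_nat (leq0n n) np) /= -/u => h1 /ler_normlP [_ h2].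
by move: h1 h2; rewrite -/(u n); lra.
Qed.

(* Gliding hump: if the rows did not tend to 0 in l1, one could cut the indices
   into consecutive blocks [[K, next K)] with rows [num K] whose mass is
   essentially carried by their block; the sign sequence [y] following row
   [num K] on each block keeps [dot (d (num K)) y] away from 0. *)
Lemma schur_null {R : realType} (d : nat -> nat -> R) :
  (forall n, exists r, l1_bound (d n) r) ->
  (forall y, (forall k, `|y k| <= 1) -> dot (d n) y @[n --> \oo] --> (0 : R)) ->
  forall e, 0 < e -> exists m, forall n, (m <= n)%N -> l1_bound (d n) e.
Proof.
move=> dl1 d0 e e0; apply: contrapT => noM.
have big m : exists n, (m <= n)%N /\ exists K, e < \sum_(0 <= k < K) `|d n k|.
  apply: contrapT => no; apply: noM; exists m => n mn K.
  by rewrite leNgt; apply/negP => eK; apply: no; exists n; split => //; exists K.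
(* With prefix and tail at most [e / 5] each, a block of mass at least [4 * (e / 5)] makes the
   pairing at least [2 * (e / 5)]. *)
have e5 : 0 < e / 5 by rewrite divr_gt0.
(* Testing on unit sequences shows that each column tends to [0], hence so does a finite sum of
   columns. *)
have prefix K : \forall n \near \oo, \sum_(0 <= k < K) `|d n k| <= e / 5.
  have : \sum_(0 <= k < K) `|d n k| @[n --> \oo] --> (0 : R).
    elim: K => [|K IH].
      by under eq_fun do rewrite big_geq //; exact: cvg_cst.
    under eq_fun do rewrite big_nat_recr //=.
    have cK : `|d n K| @[n --> \oo] --> (0 : R).
      suff /cvg_norm : d n K @[n --> \oo] --> (0 : R) by rewrite normr0; apply.
      under eq_fun do rewrite -(dot_delta (d _) K).
      by apply: d0 => j; case: eqP => _; rewrite ?normr1 ?normr0.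
    by have := cvgD IH cK; rewrite addr0; apply.
  move=> /cvgrPdist_le /(_ _ e5); apply: filterS => n.
  by rewrite sub0r normrN; apply: le_trans; exact: ler_norm.
have step K : exists nn : nat * nat, [/\ (K <= nn.1)%N, (K < nn.2)%N,
    \sum_(0 <= k < K) `|d nn.1 k| <= e / 5,
    (forall p, \sum_(nn.2 <= k < p) `|d nn.1 k| <= e / 5) &
    4 * (e / 5) <= \sum_(K <= k < nn.2) `|d nn.1 k|].
  have [m _ mP] := prefix K; have [n [mn [L eL]]] := big (maxn K m).
  have [r dr] := dl1 n; have [t tP] := l1_tail dr e5.
  (* The block must be nonempty, reach [L], where the mass exceeds [e], and reach [t], where the
     tail is small. *)
  exists (n, maxn K.+1 (maxn L t)) => /=.
  have nK : \sum_(0 <= k < K) `|d n k| <= e / 5 by apply: mP => /=; lia.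
  split; [lia|lia|exact: nK|by move=> p; apply: tP; lia|].
  set N := maxn _ _; have LN : (L <= N)%N by lia.
  have KN : (K <= N)%N by lia.
  have : e < \sum_(0 <= k < N) `|d n k|.
    apply: (lt_le_trans eL); rewrite (big_cat_nat (leq0n L) LN) /=.
    by rewrite lerDl sumr_ge0.
  rewrite (big_cat_nat (leq0n K) KN) /=; lra.
have [nn nnP] := choice step.
pose num K := (nn K).1; pose next K := (nn K).2.
(* [start k] is the left end of the block containing [k]: a block opens exactly at the [next] of the
   current one. *)
pose start := fix start k := if k is j.+1 then
  if j.+1 == next (start j) then j.+1 else start j else 0%N.
have nextP K : (K < next K)%N by case: (nnP K).
have start_block K : start K = K -> forall k, (K <= k < next K)%N -> start k = K.
  move=> sK; elim=> [|k IH] /andP[]; first by rewrite leqn0 => /eqP ->.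
  rewrite leq_eqVlt => /predU1P[<- //|Kk] kn /=.
  rewrite IH; last by rewrite -ltnS Kk ltnW.
  by rewrite (ltn_eqF kn).
have start_next K : start K = K -> start (next K) = next K.
  move=> sK; have := nextP K; case E : (next K) => [//|j] Kj /=.
  by rewrite (start_block K) // ?E ?eqxx // ltnSn andbT.
have starts m : exists2 K, (m <= K)%N & start K = K.
  elim: m => [|m [K mK sK]]; first by exists 0%N.
  by exists (next K); [exact: leq_ltn_trans mK (nextP K)|exact: start_next].
pose y k := if d (num (start k)) k < 0 then -1 else 1 : R.
have y1 k : `|y k| <= 1 by rewrite /y; case: ifP; rewrite ?normrN normr1.
have yge b k : - `|b| <= b * y k.
  have := ler_norm (- (b * y k)).
  by rewrite normrN normrM; have := ler_wpM2l (normr_ge0 b) (y1 k); lra.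
have /cvgrPdist_lt /(_ _ e5) [m _ mP] := d0 y y1.
have [K mK sK] := starts m; have [Kn KN pre post mid] := nnP K.
have := mP (num K) (leq_trans mK Kn); rewrite sub0r normrN.
apply/negP; rewrite -leNgt; apply: le_trans (ler_norm _).
have [r dr] := dl1 (num K).
apply: limr_ge; first exact: l1_dot_cvg dr y1.
near=> p; have Np : (next K <= p)%N by near: p; exact: nbhs_infty_ge.
rewrite /series /= (big_cat_nat (leq0n (next K)) Np) /=.
rewrite (big_cat_nat (leq0n K) (ltnW KN)) /=.
have := @ler_sum_nat R 0 K (fun k => - `|d (num K) k|) (fun k => d (num K) k * y k)
  (fun k _ => yge _ _).
have := @ler_sum_nat R (next K) p (fun k => - `|d (num K) k|)
  (fun k => d (num K) k * y k) (fun k _ => yge _ _).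
have -> : \sum_(K <= k < next K) d (num K) k * y k =
          \sum_(K <= k < next K) `|d (num K) k|.
  apply: eq_big_nat => k kK; rewrite /y (start_block K sK) //.
  by case: ifP => [/ltr0_norm ->|/negbT]; [ring|rewrite -leNgt => /ger0_norm ->; ring].
rewrite !sumrN; have := post p; move: pre mid; rewrite -/(num K) -/(next K).
lra.
Unshelve. all: by end_near. Qed.

(** Otherwise there are pairs of arbitrarily late rows whose differences exceed [e] in l1. Their
    pairings with each [y] bounded by [1] tend to [0], against [schur_null]. *)
Lemma schur_cauchy {R : realType} (b : nat -> nat -> R) :
  (forall n, exists r, l1_bound (b n) r) ->
  (forall y, (forall k, `|y k| <= 1) -> cvgn (fun n => dot (b n) y)) ->
  forall e, 0 < e -> exists m, forall n p, (m <= n)%N -> (m <= p)%N ->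
    l1_bound (fun k => b n k - b p k) e.
Proof.
move=> bl1 bcvg e e0; apply: contrapT => noM.
have step m : exists np : nat * nat, [/\ (m <= np.1)%N, (m <= np.2)%N &
    ~ l1_bound (fun k => b np.1 k - b np.2 k) e].
  apply: contrapT => no; apply: noM; exists m => n p mn mp.
  by apply: contrapT => nb; apply: no; exists (n, p).
have [np npP] := choice step.
have cvg_np (f : nat -> nat) (fm : forall m, (m <= f m)%N) : f @ \oo --> \oo.
  move=> A [m _ mA]; exists m => // n mn; apply: mA; exact: leq_trans mn (fm n).
have [||m mP] := @schur_null R (fun m k => b (np m).1 k - b (np m).2 k) _ _ e e0.
- move=> m; have [r br] := bl1 (np m).1; have [s bs] := bl1 (np m).2.
  by exists (r + s); exact: l1_boundD br (l1_boundN bs).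
- move=> y y1; have cv := bcvg y y1.
  have E m : dot (fun k => b (np m).1 k - b (np m).2 k) y =
      dot (b (np m).1) y - dot (b (np m).2) y.
    have [r br] := bl1 (np m).1; have [s bs] := bl1 (np m).2.
    exact: dotB br bs y1.
  under eq_fun do rewrite E.
  rewrite -(subrr (limn (fun n => dot (b n) y))); apply: cvgB.
    apply: (cvg_comp _ _ (cvg_np (fun m => (np m).1) _) cv).
    by move=> k; case: (npP k).
  apply: (cvg_comp _ _ (cvg_np (fun m => (np m).2) _) cv).
  by move=> k; case: (npP k).
by case: (npP m) => _ _; apply; exact: mP.
Qed.

(** Letting [p] tend to infinity in each partial sum of the Cauchy estimate replaces [b p] by
    [beta]; a single late row then bounds [beta] in l1. *)
Lemma schur_limit {R : realType} (b : nat -> nat -> R) (beta : nat -> R) :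
  (forall n, exists r, l1_bound (b n) r) ->
  (forall y, (forall k, `|y k| <= 1) -> cvgn (fun n => dot (b n) y)) ->
  (forall k, b n k @[n --> \oo] --> beta k) ->
  (exists r, l1_bound beta r) /\
  forall e, 0 < e -> exists m, forall n, (m <= n)%N ->
    l1_bound (fun k => b n k - beta k) e.
Proof.
move=> bl1 bcvg bbeta.
have lim e : 0 < e -> exists m, forall n, (m <= n)%N ->
    l1_bound (fun k => b n k - beta k) e.
  move=> e0; have [m mP] := schur_cauchy _ bl1 bcvg _ e0.
  exists m => n mn K.
  have cv : \sum_(0 <= k < K) `|b n k - b p k| @[p --> \oo] -->
            \sum_(0 <= k < K) `|b n k - beta k|.
    elim: K => [|K IH].
      rewrite big_geq //; under eq_fun do rewrite big_geq //; exact: cvg_cst.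
    rewrite big_nat_recr //=; under eq_fun do rewrite big_nat_recr //=.
    apply: cvgD => //; apply: cvg_norm; apply: cvgB => //; exact: cvg_cst.
  rewrite -(cvg_lim _ cv) //; apply: limr_le; first exact: cvgP cv.
  by exists m => // p mp; exact: mP.
split => //; have [m mP] := lim 1 ltr01; have [r br] := bl1 m.
exists (r + 1) => K.
apply: le_trans (l1_boundD br (l1_boundN (mP m (leqnn m))) K).
by apply: ler_sum => k _; rewrite opprB addrC subrK.
Qed.

(** * Extended-real row sums and limits superior *)

Lemma abs_sum_leP {R : realType} (u : nat -> R) (r : R) :
  (abs_sum u <= r%:E)%E <-> l1_bound u r.
Proof.
split=> [ur K|ur].
  rewrite -lee_fin; apply: le_trans ur; rewrite -sumEFin.
  by apply: nneseries_lim_ge => k _ _; rewrite lee_fin.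
apply: lime_le.
  by apply: is_cvg_nneseries => k _ _; rewrite lee_fin.
by apply: nearW => K; rewrite sumEFin lee_fin; exact: ur.
Qed.

Lemma abs_sum_ge0 {R : realType} (u : nat -> R) : (0 <= abs_sum u)%E.
Proof. by apply: nneseries_ge0 => k _ _; rewrite lee_fin. Qed.

Lemma abs_sum_cvg0P {R : realType} (u : nat -> nat -> R) :
  abs_sum (u n) @[n --> \oo] --> 0%E <->
  forall e, 0 < e -> exists m, forall n, (m <= n)%N -> l1_bound (u n) e.
Proof.
split=> [/fine_cvgP[fu /cvgrPdist_le ufu] e e0|ue].
  have [m1 _ m1P] := fu; have [m2 _ m2P] := ufu e e0.
  exists (maxn m1 m2) => n mn; apply/abs_sum_leP.
  have /= fn := m1P n ltac:(rewrite /=; lia).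
  have /= := m2P n ltac:(rewrite /=; lia).
  by rewrite sub0r normrN -(fineK fn) lee_fin; apply: le_trans; exact: ler_norm.
apply/fine_cvgP; split.
  have [m mP] := ue 1 ltr01; exists m => // n mn.
  rewrite ge0_fin_numE ?abs_sum_ge0 //.
  by apply: le_lt_trans (ltry 1); apply/abs_sum_leP; exact: mP.
apply/cvgrPdist_le => e e0; have [m mP] := ue e e0; exists m => // n mn /=.
rewrite sub0r normrN ger0_norm ?fine_ge0 ?abs_sum_ge0 //.
have le : (abs_sum (u n) <= e%:E)%E by apply/abs_sum_leP; exact: mP.
rewrite -lee_fin fineK // ge0_fin_numE ?abs_sum_ge0 //.
exact: le_lt_trans le (ltry _).
Qed.

(** [limn_esup] is an infimum of suprema over index sets containing a tail, so a strict bound on it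
    bounds one of these suprema. *)
Lemma limn_esup_lt {R : realType} (u : nat -> \bar R) (e : \bar R) :
  (limn_esup u < e)%E -> exists m, forall n, (m <= n)%N -> (u n <= e)%E.
Proof.
move=> /ereal_inf_ltP[_ [A [m _ mA] <-]] lt; exists m => n mn.
apply: le_trans (ltW lt); apply: ereal_sup_ubound; exists n => //; exact: mA.
Qed.

Lemma limn_esup_ge0 {R : realType} (u : nat -> \bar R) :
  (forall n, 0 <= u n)%E -> (0 <= limn_esup u)%E.
Proof.
move=> u0; apply: le_ereal_inf_tmp => _ [A [m _ mA] <-].
apply: le_trans (u0 m) _; apply: ereal_sup_ubound.
by exists m => //; apply: mA => /=.
Qed.

(** * Sup norm and finite nets *)

Lemma le_sup_norm {R : realType} (x : nat -> R) (M : R) :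
  bounded_fun (x : nat -> R^o) -> sup_norm x <= M -> forall k, `|x k| <= M.
Proof.
move=> /bounded_funE[C xC] xM k; apply: le_trans xM.
by apply: ub_le_sup; [exists C => _ [j _ <-]|exists k].
Qed.

Lemma sup_norm_le {R : realType} (x : nat -> R) (M : R) :
  (forall k, `|x k| <= M) -> sup_norm x <= M.
Proof.
by move=> xM; apply: ge_sup => [|_ [k _ <-]] //; exists `|x 0%N|, 0%N.
Qed.

(** The net is the grid of step [e] starting at [- C]; truncating [(x + C) / e] selects the grid
    point at or just below [x]. *)
Lemma interval_net {R : realType} (C e : R) : 0 < e ->
  exists s : seq R, forall x, `|x| <= C -> exists2 t, t \in s & `|x - t| <= e.
Proof.
move=> e0; pose N := Num.trunc (2 * C / e).
exists [seq - C + e * i%:R | i <- iota 0 N.+1] => x xC.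
have /ler_normlP [x1 x2] := xC.
have q0 : 0 <= (x + C) / e by rewrite divr_ge0 //; [lra|exact: ltW].
have /andP[q1 q2] := truncn_itv q0; set q := Num.trunc _ in q1 q2.
exists (- C + e * q%:R).
  apply/mapP; exists q => //; rewrite mem_iota /= add0n ltnS.
  apply: le_truncn; rewrite ler_pM2r ?invr_gt0 //; lra.
have xE : x + C = e * ((x + C) / e) by field; rewrite gt_eqF.
have h1 : e * q%:R <= x + C by rewrite [leRHS]xE ler_pM2l.
have h2 : x + C <= e * (q%:R + 1) by rewrite [leLHS]xE ler_pM2l // natr1 ltW.
by rewrite ler_norml; apply/andP; split; lra.
Qed.

(* The first [N] coordinates range over a bounded subset of [R^N]; the tails are
   within [r] of one of the finitely many constants in [ts]. *)
Lemma finite_cover {R : realType} (Q : set (nat -> R)) (ts : seq R) N (r e : R) :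
  0 < e -> (forall n, exists C : R, forall z, Q z -> `|z n| <= C) ->
  (forall z, Q z -> exists2 t, t \in ts & forall n, (N <= n)%N -> `|z n - t| <= r) ->
  exists cs : seq (nat -> R),
    (forall c, c \in cs -> exists2 t, t \in ts & c @ \oo --> t) /\
    forall z, Q z -> exists2 c, c \in cs & forall n, `|z n - c n| <= Num.max e r.
Proof.
move=> e0 Qb Qt.
(* Induction on [N] starts from constant sequences and overwrites coordinate [N] by each point of a
   grid. *)
have [cs [csN csP]] : exists cs : seq (nat -> R),
    (forall c, c \in cs -> exists2 t, t \in ts & forall n, (N <= n)%N -> c n = t) /\
    forall z t, Q z -> t \in ts -> exists2 c, c \in cs &
      (forall n, (n < N)%N -> `|z n - c n| <= e) /\ (forall n, (N <= n)%N -> c n = t).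
  elim: N {Qt} => [|N [cs [csN csP]]].
    exists [seq (fun=> t) | t <- ts]; split=> [c /mapP[t tts ->]|z t Qz tts].
      by exists t.
    by exists (fun=> t) => //; apply/mapP; exists t.
  have [C QC] := Qb N; have [net netP] := interval_net C _ e0.
  exists [seq (fun n => if n == N then s else c n) | c <- cs, s <- net].
  split=> [_ /allpairsP[[c s] /= [ccs _ ->]]|z t Qz tts].
    have [t tts cN] := csN c ccs; exists t => // n Nn.
    by rewrite gtn_eqF // cN // ltnW.
  have [c ccs [c1 c2]] := csP z t Qz tts; have [s snet zs] := netP _ (QC z Qz).
  exists (fun n => if n == N then s else c n).
    by apply/allpairsP; exists (c, s).
  split=> n; last by move=> Nn; rewrite gtn_eqF // c2 // ltnW.
  by rewrite ltnS leq_eqVlt; case: eqVneq => [->|_] //=; exact: c1.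
exists cs; split=> [c /csN[t tts ct]|z Qz].
  by exists t => //; apply: cvg_near_cst; exists N.
have [t tts zt] := Qt z Qz; have [c ccs [c1 c2]] := csP z t Qz tts.
exists c => // n; rewrite le_max; case: (ltnP n N) => [nN|Nn].
  by rewrite c1.
by rewrite c2 // zt // orbT.
Qed.

(** * Fibonacci growth and the inverse of [Fhat] *)

Lemma fib_gt0 n : (0 < fib n)%N.
Proof.
suff: (0 < fib n)%N && (0 < fib n.+1)%N by case/andP.
by elim: n => // n /andP[h1 h2]; rewrite h2 /= addn_gt0 h1 orbT.
Qed.

Lemma fibSS n : fib n.+2 = (fib n.+1 + fib n)%N.
Proof. by []. Qed.

(** By monotonicity [f_(n+2) >= 2 f_n], so the product at least doubles at each step. *)
Lemma fib_mul_ge n : (2 ^ n <= fib n * fib n.+1)%N.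
Proof.
elim: n => // n IH; rewrite fibSS expnS.
apply: leq_trans (leq_mul (leqnn 2) IH) _.
case: n {IH} => // n; rewrite fibSS; nia.
Qed.

Definition fib_weight {R : realType} (k : nat) : R :=
  ((fib k)%:R * (fib k.+1)%:R)^-1.

Lemma fib_neq0 (R : realType) n : (fib n)%:R != 0 :> R.
Proof. by rewrite pnatr_eq0 -lt0n fib_gt0. Qed.

Lemma fib_weight_ge0 {R : realType} k : 0 <= fib_weight k :> R.
Proof. by rewrite invr_ge0 mulr_ge0. Qed.

Lemma fib_weight_l1 (R : realType) : l1_bound (@fib_weight R) 2.
Proof.
(* The constant is sharpened to the partial sum of the geometric series, which can be carried
   through the induction. *)
move=> K; apply: (@le_trans _ _ (2 - 2 * 2^-1 ^+ K)); last first.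
  by rewrite gerBl mulr_ge0 // exprn_ge0.
elim: K => [|K IH]; first by rewrite big_geq // expr0 mulr1 subrr.
rewrite big_nat_recr //=; apply: (le_trans (lerD IH (lexx _))).
rewrite ger0_norm ?fib_weight_ge0 //.
have : fib_weight K <= 2^-1 ^+ K :> R.
  rewrite /fib_weight exprVn lef_pV2 ?posrE; first last.
  - by rewrite exprn_gt0.
  - by rewrite mulr_gt0 ?ltr0n ?fib_gt0.
  by rewrite -natrX -natrM ler_nat fib_mul_ge.
by rewrite exprS; lra.
Qed.

Definition Fhat_inv {R : realType} (y : nat -> R) (j : nat) : R :=
  (fib j.+1)%:R ^+ 2 * \sum_(0 <= k < j.+1) fib_weight k * y k.

Lemma Fhat_invK (R : realType) (y : nat -> R) : Fhat (Fhat_inv y) = y.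
Proof.
apply/funext => -[|n].
  by rewrite /Fhat /Fhat_inv big_nat1 /fib_weight /=; field.
rewrite /Fhat /Fhat_inv; set s := \sum_(0 <= k < n.+1) _.
have -> : \sum_(0 <= k < n.+2) fib_weight k * y k = s + fib_weight n.+1 * y n.+1.
  by rewrite big_nat_recr.
have := fib_neq0 R n.+1; have := fib_neq0 R n.+2; rewrite /fib_weight.
by move: (fib n.+1) (fib n.+2) => f g f0 g0; field; apply/andP.
Qed.

(** [Fhat] is lower triangular with nonzero diagonal. Injectivity turns the right inverse [Fhat_inv]
    into a two-sided one. *)
Lemma Fhat_inj (R : realType) : injective (@Fhat R).
Proof.
move=> x x' e; apply/funext; elim=> [|n IH].
  by have := congr1 (@^~ 0%N) e; rewrite /Fhat /= divr1 !mul1r.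
have := congr1 (@^~ n.+1) e; rewrite /Fhat IH => /addIr /mulfI; apply.
by rewrite mulf_neq0 ?invr_neq0 ?fib_neq0.
Qed.

Lemma FhatK (R : realType) (x : nat -> R) : Fhat_inv (Fhat x) = x.
Proof. by apply: Fhat_inj; rewrite Fhat_invK. Qed.

(** * Rows of [abar] and summation by parts *)

Section rows.
Context {R : realType} (a : nat -> nat -> R) (n : nat).
Hypothesis a_cvg : forall y, (exists M, forall k, `|y k| <= M) ->
  cvgn (series (fun k => a n k * Fhat_inv y k)).

Let S := series (fun j => (fib j.+1)%:R ^+ 2 * a n j).

(** The sequence [f_(j+1)^2] is the preimage under [Fhat] of the unit sequence at [0], to which
    [a_cvg] applies. *)
Let S_cvg : cvgn S.
Proof.
have d1 : exists M : R, forall k, `|(k == 0%N)%:R : R| <= M.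
  by exists 1 => k; case: (k == 0)%N; rewrite ?normr1 ?normr0.
rewrite /S; suff -> : (fun j => (fib j.+1)%:R ^+ 2 * a n j) =
    (fun j => a n j * Fhat_inv (fun k => (k == 0%N)%:R) j) by exact: a_cvg d1.
apply/funext => j; rewrite /Fhat_inv big_nat_recl // big1 => [|i _]; last first.
  by rewrite mulr0.
by rewrite /fib_weight /= addr0 !mulr1 invr1 !mulr1 mulrC.
Qed.

Let T N := limn S - S N.

Let T_cvg0 : T @ \oo --> (0 : R).
Proof.
by rewrite -(subrr (limn S)); apply: cvgB => //; exact: cvg_cst.
Qed.

(** [T k] is the tail of the series [S] from [k], and the weight factors out of the sum defining
    [abar]. *)
Lemma abarE k : abar a n k = fib_weight k * T k.
Proof.
apply: cvg_lim => //.
apply: (@cvg_trans _ ((fun N => fib_weight k * (S N - S k)) @ \oo)).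
  apply: near_eq_cvg; near=> N.
  have kN : (k <= N)%N by near: N; exact: nbhs_infty_ge.
  rewrite /S /series /= (big_cat_nat (leq0n k) kN) /= addrAC subrr add0r.
  rewrite big_distrr /=; apply: eq_bigr => j _.
  by rewrite /fib_weight; ring.
by apply: cvgM; [exact: cvg_cst|apply: cvgB => //; exact: cvg_cst].
Unshelve. all: by end_near. Qed.

(** The tails [T] are bounded because they converge, and the weights are summable. *)
Lemma abar_l1 : exists r, l1_bound (abar a n) r.
Proof.
have /bounded_funE [M TM] : bounded_fun (T : nat -> R^o).
  by apply: cvg_seq_bounded; apply/cvg_ex; exists 0.
have M0 : 0 <= M by exact: le_trans (TM 0%N).
exists (2 * M) => K; apply: le_trans (ler_wpM2r M0 (@fib_weight_l1 R K)).
rewrite mulr_suml; apply: ler_sum => k _.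
by rewrite abarE normrM ler_wpM2l.
Qed.

(* Summation by parts: the tails [T N] of the series of [f_(j+1)^2 a_nj] tend
   to [0], while the partial sums of [fib_weight k * y k] stay bounded. *)
Lemma matrix_opE y : (exists M, forall k, `|y k| <= M) ->
  matrix_op a (Fhat_inv y) n = dot (abar a n) y.
Proof.
move=> [M yM].
have parts N : series (fun k => a n k * Fhat_inv y k) N =
    series (fun k => abar a n k * y k) N - T N * series (fun k => fib_weight k * y k) N.
  elim: N => [|N IH]; first by rewrite /series /= !big_geq // mulr0 subr0.
  have TS : T N.+1 = T N - (fib N.+1)%:R ^+ 2 * a n N.
    by rewrite /T /S seriesSr; ring.
  rewrite [LHS]seriesSr IH [series _ N.+1 in RHS]seriesSr abarE TS.
  have -> : Fhat_inv y N = (fib N.+1)%:R ^+ 2 *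
      (series (fun k => fib_weight k * y k) N + fib_weight N * y N).
    by rewrite /Fhat_inv big_nat_recr.
  by rewrite seriesSr; ring.
have [r br] := abar_l1.
rewrite /matrix_op (_ : series (fun k => a n k * Fhat_inv y k) = 
    series (fun k => abar a n k * y k) \- T \* series (fun k => fib_weight k * y k));
  last exact/funext.
apply: cvg_lim => //; rewrite -[X in _ --> X]subr0; apply: cvgB.
  exact: l1_dot_cvg br yM.
rewrite -[X in _ --> X](mul0r (limn (series (fun k => fib_weight k * y k)))).
by apply: cvgM => //; exact: l1_dot_cvg (@fib_weight_l1 R) yM.
Qed.

End rows.

(** * Covering the image and bounding the measure of noncompactness *)

(** [ell_infty], [c_conv] and [c_null] are instances up to conversion, so one covering argument
    serves all three. *)
Definition sup_space {R : realType} (Y : set (nat -> R)) : seq_space R :=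
  SeqSpace Y (@sup_norm R).

Section image.
Context {R : realType} (Y : set (nat -> R)) (a : nat -> nat -> R).
Hypothesis aY : matrix_class (ell_infty_Fhat R) (sup_space Y) a.

Let a_cvg n y : (exists M, forall k, `|y k| <= M) ->
  cvgn (series (fun k => a n k * Fhat_inv y k)).
Proof.
by move=> /bounded_funE yb; apply: (aY (Fhat_inv y) _).1; rewrite /= Fhat_invK.
Qed.

Lemma abar_row_l1 n : exists r, l1_bound (abar a n) r.
Proof. exact: abar_l1 (@a_cvg n). Qed.

Lemma matrix_op_abar x M : (forall k, `|Fhat x k| <= M) ->
  matrix_op a x = fun n => dot (abar a n) (Fhat x).
Proof.
move=> xM; apply/funext => n; rewrite -{1}(FhatK _ x).
by apply: matrix_opE; [exact: a_cvg|exists M].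
Qed.

Lemma dot_abar_image y M : (forall k, `|y k| <= M) ->
  Y (fun n => dot (abar a n) y).
Proof.
move=> yM; have := @matrix_op_abar (Fhat_inv y) M; rewrite Fhat_invK => <- //.
by apply: (aY (Fhat_inv y) _).2; rewrite /= Fhat_invK; apply/bounded_funE; exists M.
Qed.

Lemma mnc_norm_ge0 :
  (0 <= mnc_norm (ell_infty_Fhat R) (sup_space Y) (matrix_op a))%E.
Proof. by apply: le_ereal_inf_tmp => _ [e [e0 _] <-]; rewrite lee_fin ltW. Qed.

(** The limit row: [0] in (a) and (b), [alphabar a] in (c). The points [t] of the net are the limits
    of the centres, so [alpha_net] requires sequences tending to [t] to lie in [Y]. *)
Variable alpha : nat -> R.
Hypothesis alpha_l1 : exists s, l1_bound alpha s.
Hypothesis alpha_net : forall M e : R, 0 < e -> exists ts : seq R,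
  (forall t, t \in ts -> forall c : nat -> R, c @ \oo --> t -> Y c) /\
  forall y, (forall k, `|y k| <= M) -> exists2 t, t \in ts & `|dot alpha y - t| <= e.

(** From [N] on, the coordinates of [A x] lie within [r * M] of [dot alpha (Fhat x)], hence within
    [r * M + e] of a net point, and [finite_cover] applies. Balls are open, whence the strictly
    larger [r']. *)
Lemma image_cover Q (M r e : R) N :
  (forall x, Q x -> forall k, `|Fhat x k| <= M) ->
  0 <= M -> 0 < e -> (forall n, (N <= n)%N -> l1_bound (fun k => abar a n k - alpha k) r) ->
  exists (m : nat) (c : 'I_m -> nat -> R), (forall i, Y (c i)) /\
    forall r', r * M + e < r' -> matrix_op a @` Q `<=`
      \bigcup_(i in setT) metric_ball Y (seq_dist (sup_space Y)) (c i) r'.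
Proof.
move=> QM M0 e0 ar.
have r0 : 0 <= r := l1_bound_ge0 (ar N (leqnn N)).
have [ts [tsY tsP]] := alpha_net M e e0.
have [s als] := alpha_l1.
have [||cs [csY csP]] := @finite_cover R (matrix_op a @` Q) ts N (r * M + e) e e0.
- move=> n; have [q aq] := abar_row_l1 n; exists (q * M) => _ [x Qx <-].
  by rewrite (matrix_op_abar x M (QM x Qx)); exact: l1_dot_le aq (QM x Qx).
- move=> _ [x Qx <-]; have [t tts xt] := tsP _ (QM x Qx); exists t => // n Nn.
  rewrite (matrix_op_abar x M (QM x Qx)); have [q aq] := abar_row_l1 n.
  have := l1_dot_le (ar n Nn) (QM x Qx); rewrite (dotB aq als (QM x Qx)) => d.
  apply: le_trans (lerD d xt); apply: le_trans (ler_normD _ _).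
  by rewrite addrA subrK.
exists (size cs), (fun i => nth (fun=> 0) cs i); split=> [i|r' rr'].
  by have [t tts] := csY _ (mem_nth (fun=> 0) (ltn_ord i)); exact: tsY.
move=> _ [x Qx <-]; have [c ccs xc] := csP _ (imageP _ Qx).
have ics : (index c cs < size cs)%N by rewrite index_mem.
exists (Ordinal ics) => //=; split.
  by rewrite (matrix_op_abar x M (QM x Qx)); exact: dot_abar_image (QM x Qx).
apply: le_lt_trans rr'; apply: sup_norm_le => k.
rewrite nth_index // distrC; apply: le_trans (xc k) _.
by rewrite ge_max lexx andbT lerDr mulr_ge0.
Qed.

Lemma mnc_norm_le (r e : R) N : r < e ->
  (forall n, (N <= n)%N -> l1_bound (fun k => abar a n k - alpha k) r) ->
  (mnc_norm (ell_infty_Fhat R) (sup_space Y) (matrix_op a) <= e%:E)%E.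
Proof.
move=> re ar; have r0 : 0 <= r := l1_bound_ge0 (ar N (leqnn N)).
(* Thirds of the gap keep the covering bound [r + d], the radius [r + 2 * d] and [e = r + 3 * d]
   strictly ordered. *)
pose d := (e - r) / 3.
have d0 : 0 < d by rewrite divr_gt0 // subr_gt0.
have eE : e = r + 3 * d by rewrite /d; field.
have [|m [c [cY cP]]] := @image_cover (unit_sphere (ell_infty_Fhat R)) 1 r d N _ ler01 d0 ar.
  by move=> x [xb /= x1]; apply: le_sup_norm => //; rewrite x1.
apply: ereal_inf_lbound; exists e => //; split; first by lra.
exists m, c, (fun=> r + 2 * d); split => //.
  by move=> _; apply/andP; split; lra.
by apply: cP; lra.
Qed.

Hypothesis rows_cvg : forall e, 0 < e -> exists m, forall n, (m <= n)%N ->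
  l1_bound (fun k => abar a n k - alpha k) e.

Lemma mnc_norm_eq0 :
  mnc_norm (ell_infty_Fhat R) (sup_space Y) (matrix_op a) = 0%E.
Proof.
apply/eqP; rewrite eq_le mnc_norm_ge0 andbT; apply/lee_addgt0Pr => e e0.
have e2 : 0 < e / 2 by rewrite divr_gt0.
have [m mP] := rows_cvg _ e2; rewrite add0e; apply: mnc_norm_le mP.
by lra.
Qed.

Lemma compact_op_matrix :
  compact_op (ell_infty_Fhat R) (sup_space Y) (matrix_op a).
Proof.
(* [K] is a positive bound for [Q]; the tolerances [e / (3 * K)] and [e / 3] add up to
   [2 * e / 3 < e] after scaling by [K]. *)
move=> Q [QX [M QM]] e e0; pose K := `|M| + 1.
have K0 : 0 < K by rewrite ltr_wpDl.
have r0 : 0 < e / (3 * K) by rewrite divr_gt0 // mulr_gt0.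
have d0 : 0 < e / 3 by rewrite divr_gt0.
have [N NP] := rows_cvg _ r0.
have [|m [c [cY cP]]] := @image_cover Q K _ (e / 3) N _ (ltW K0) d0 NP.
  move=> x Qx; apply: le_sup_norm; first exact: QX.
  by apply: le_trans (QM x Qx) _; rewrite (le_trans (ler_norm _)) // lerDl.
exists m, c; split => //; apply: cP.
have -> : e / (3 * K) * K = e / 3 by field; rewrite gt_eqF.
by lra.
Qed.

End image.

(** * Application to the three target spaces *)

Lemma zero_net {R : realType} (Y : set (nat -> R)) :
  (forall c : nat -> R, c @ \oo --> (0 : R) -> Y c) ->
  forall M e : R, 0 < e -> exists ts : seq R,
  (forall t, t \in ts -> forall c : nat -> R, c @ \oo --> t -> Y c) /\
  forall y, (forall k, `|y k| <= M) ->
    exists2 t, t \in ts & `|dot (fun=> 0) y - t| <= e.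
Proof.
move=> Y0 M e e0; exists [:: 0]; split=> [t|y _].
  by rewrite inE => /eqP ->; exact: Y0.
exists 0; rewrite ?inE //; suff -> : dot (fun=> 0) y = 0 by rewrite subrr normr0 ltW.
apply: cvg_lim => //; rewrite (_ : series _ = fun=> 0); first exact: cvg_cst.
by apply/funext => n; rewrite /series /= big1 // => k _; rewrite mul0r.
Qed.

Lemma zero_l1 {R : realType} : exists s : R, l1_bound (fun=> 0 : R) s.
Proof. by exists 0 => K; rewrite big1 // => k _; rewrite normr0. Qed.

(** The values [dot alpha y] fill at most an interval of radius [s * M], and every real limit is
    admissible in [c_conv]. *)
Lemma l1_net {R : realType} (alpha : nat -> R) : (exists s, l1_bound alpha s) ->
  forall M e : R, 0 < e -> exists ts : seq R,
  (forall t, t \in ts -> forall c : nat -> R, c @ \oo --> t -> cvgn c) /\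
  forall y, (forall k, `|y k| <= M) -> exists2 t, t \in ts & `|dot alpha y - t| <= e.
Proof.
move=> [s als] M e e0; have [net netP] := interval_net (s * M) _ e0.
exists net; split=> [t _ c ct|y yM]; first exact: cvgP ct.
by apply: netP; exact: l1_dot_le als yM.
Qed.

Lemma mnc_ell_infty_le {R : realType} (a : nat -> nat -> R) :
  matrix_class (ell_infty_Fhat R) (ell_infty R) a ->
  (mnc_norm (ell_infty_Fhat R) (ell_infty R) (matrix_op a)
    <= limn_esup (fun n => abs_sum (abar a n)))%E.
Proof.
move=> aY; have := limn_esup_ge0 _ (fun n => abs_sum_ge0 (abar a n)).
(* Nonnegativity excludes [-oo], and [+oo] is trivial. For finite [l], half of [e] is spent on each
   of [l < l + e / 2 < l + e]. *)
case E : limn_esup => [l| |] //= _; last exact: leey.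
apply/lee_addgt0Pr => e e0.
have le : (limn_esup (fun n => abs_sum (abar a n)) < (l + e / 2)%:E)%E.
  by rewrite E lte_fin ltrDl divr_gt0.
have [m mP] := limn_esup_lt _ _ le.
rewrite -EFinD; apply: (@mnc_norm_le R _ a aY (fun=> 0) zero_l1 _ (l + e / 2) _ m).
- by apply: zero_net => c c0; apply: cvg_seq_bounded; exact: cvgP c0.
- by lra.
- move=> n mn; under eq_fun do rewrite subr0.
  exact/abs_sum_leP/mP.
Qed.

(** Every bounded [y] is some [Fhat x], so the rows of [abar] converge weakly; unit sequences give
    the limits [alphabar]. *)
Lemma alphabar_rows {R : realType} (a : nat -> nat -> R) :
  matrix_class (ell_infty_Fhat R) (c_conv R) a ->
  (exists s, l1_bound (alphabar a) s) /\
  forall e, 0 < e -> exists m, forall n, (m <= n)%N ->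
    l1_bound (fun k => abar a n k - alphabar a k) e.
Proof.
move=> aY; apply: schur_limit.
- exact: (abar_row_l1 _ _ aY).
- by move=> y y1; exact: (dot_abar_image _ _ aY y 1 y1).
- move=> k; have d1 j : `|(j == k)%:R : R| <= 1.
    by case: (j == k); rewrite ?normr1 ?normr0.
  have := dot_abar_image _ _ aY _ 1 d1.
  rewrite (_ : (fun n => _) = abar a ^~ k); first exact.
  by apply/funext => n; exact: dot_delta.
Qed.

Lemma abar_rows_null {R : realType} (a : nat -> nat -> R) :
  matrix_class (ell_infty_Fhat R) (c_null R) a ->
  forall e, 0 < e -> exists m, forall n, (m <= n)%N -> l1_bound (abar a n) e.
Proof.
move=> aY; apply: schur_null; first exact: (abar_row_l1 _ _ aY).
by move=> y y1; exact: (dot_abar_image _ _ aY y 1 y1).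
Qed.

Theorem theorem3p3 (R : realType) (a : nat -> nat -> R) :
  (matrix_class (ell_infty_Fhat R) (ell_infty R) a ->
    (0 <= mnc_norm (ell_infty_Fhat R) (ell_infty R) (matrix_op a))%E /\
    (mnc_norm (ell_infty_Fhat R) (ell_infty R) (matrix_op a)
      <= limn_esup (fun n => abs_sum (abar a n)))%E /\
    (abs_sum (abar a n) @[n --> \oo] --> 0%E ->
     compact_op (ell_infty_Fhat R) (ell_infty R) (matrix_op a))) /\
  (matrix_class (ell_infty_Fhat R) (c_null R) a ->
    mnc_norm (ell_infty_Fhat R) (c_null R) (matrix_op a)
      = limn_esup (fun n => abs_sum (abar a n)) /\
    (compact_op (ell_infty_Fhat R) (c_null R) (matrix_op a) <->
     abs_sum (abar a n) @[n --> \oo] --> 0%E)) /\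
  (matrix_class (ell_infty_Fhat R) (c_conv R) a ->
    ((2^-1)%:E * limn_esup (fun n => abs_sum (fun k => (abar a n k - alphabar a k)%R))
      <= mnc_norm (ell_infty_Fhat R) (c_conv R) (matrix_op a))%E /\
    (mnc_norm (ell_infty_Fhat R) (c_conv R) (matrix_op a)
      <= limn_esup (fun n => abs_sum (fun k => (abar a n k - alphabar a k)%R)))%E /\
    (compact_op (ell_infty_Fhat R) (c_conv R) (matrix_op a) <->
     abs_sum (fun k => (abar a n k - alphabar a k)%R) @[n --> \oo] --> 0%E)).
Proof.
(* Recasts the rows as deviations from [alpha = 0], the form used by the covering lemmas. *)
have sub0 : (forall e, 0 < e -> exists m, forall n, (m <= n)%N -> l1_bound (abar a n) e) ->
    forall e, 0 < e -> exists m, forall n, (m <= n)%N ->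
      l1_bound (fun k => abar a n k - (fun=> 0) k) e.
  move=> rows e /rows[m mP]; exists m => n /mP; by under eq_fun do rewrite subr0.
split; [|split] => aY.
- split; first exact: (mnc_norm_ge0 _ a).
  split; first exact: mnc_ell_infty_le aY.
  move=> /abs_sum_cvg0P /sub0 rows; apply: (compact_op_matrix _ a aY _ zero_l1 _ rows).
  by apply: zero_net => c c0; apply: cvg_seq_bounded; exact: cvgP c0.
- have rows := abar_rows_null a aY.
  have net := @zero_net R (carrier (c_null R)) (fun c c0 => c0).
  have lim : abs_sum (abar a n) @[n --> \oo] --> 0%E by apply/abs_sum_cvg0P.
  split; last by split=> // _; exact: (compact_op_matrix _ a aY _ zero_l1 net (sub0 rows)).
  by rewrite (cvg_limn_einf_sup lim).2 (mnc_norm_eq0 _ a aY _ zero_l1 net (sub0 rows)).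
- have [al1 rows] := alphabar_rows a aY; have net := l1_net _ al1.
  have lim : abs_sum (fun k => abar a n k - alphabar a k) @[n --> \oo] --> 0%E.
    exact/abs_sum_cvg0P.
  (* Both estimates reduce to [0 <= 0], and both sides of the equivalence hold. *)
  rewrite (cvg_limn_einf_sup lim).2 (mnc_norm_eq0 _ a aY _ al1 net rows) mule0.
  split => //; split => //; split=> // _; exact: (compact_op_matrix _ a aY _ al1 net rows).
Qed.
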